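(* Let $n\geqslant 3$ and $k\geqslant 2$. Then there exist extensions of the modal logic $\mathbf{K4B}_{n}\oplus\mathsf{Wid}_{k}^{+}$ that are not finitely axiomatizable.
   Context: Modal formulas are built from (countably many) propositional variables with truth-functional operators and $\Box$ (with $\Diamond=\lnot\Box\lnot$). A (normal) modal logic is a set of modal formulas containing all truth-functional tautologies and $\Box(p\to q)\to(\Box p\to\Box q)$, closed under modus ponens, substitution and necessitation. $\mathbf{K}$ is the smallest modal logic; $\mathbf{K4}$ is the smallest modal logic containing $\Box p\to\Box\Box p$. An extension of a modal logic $\mathbf{L}$ is a modal logic $\mathbf{L}'\supseteq\mathbf{L}$. For a set $\Delta$ of formulas, $\mathbf{L}\oplus\Delta$ is the smallest modal logic including $\mathbf{L}\cup\Delta$, and $\mathbf{L}\oplus\phi=\mathbf{L}\oplus\{\phi\}$. A modal logic is finitely axiomatizable if it equals $\mathbf{K}\oplus\Delta$ for some finite $\Delta$. Formulas: $\mathsf{B}_{1}=\Diamond\Box p_{1}\to p_{1}$ and $\mathsf{B}_{i+1}=\Diamond(\Box p_{i+1}\wedge\lnot\mathsf{B}_{i})\to p_{i+1}$ for $i\geqslant1$; $\mathbf{K4B}_{n}=\mathbf{K4}\oplus\mathsf{B}_{n}$. For $k\geqslant1$, $$\mathsf{Wid}_{k}^{+}=\Big(q\wedge\Diamond\big(\Box\lnot q\wedge\bigwedge_{0\leqslant i\leqslant k}\Diamond p_{i}\big)\Big)\to\bigvee_{0\leqslant i\neq j\leqslant k}\Diamond(p_{i}\wedge(p_{j}\vee\Diamond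 p_{j})).$$ *)

(* Defs.v *)
From mathcomp Require Import all_boot.
From mathcomp Require Import boolp classical_sets cardinality.

Set Implicit Arguments.
Unset Strict Implicit.
Unset Printing Implicit Defensive.

Local Open Scope classical_set_scope.

(* Falsum and implication are a functionally complete set of truth-functional
   operators; the others are abbreviations. *)
Inductive formula : Type :=
| Var of nat
| Bot
| Imp of formula & formula
| Box of formula.

Definition Neg (a : formula) : formula := Imp a Bot.
Definition Top : formula := Neg Bot.
Definition Or (a b : formula) : formula := Imp (Neg a) b.
Definition And (a b : formula) : formula := Neg (Imp a (Neg b)).
Definition Dia (a : formula) : formula := Neg (Box (Neg a)).

Fixpoint subst (s : nat -> formula) (a : formula) : formula :=
  match a with
  | Var i => s i
  | Bot => Bot
  | Imp b c => Imp (subst s b) (subst s c)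
  | Box b => Box (subst s b)
  end.

(* Boxed formulas are treated as atoms: only the values of v at formulas of the
   form Var i and Box b are used. *)
Fixpoint truth_value (v : formula -> bool) (a : formula) : bool :=
  match a with
  | Bot => false
  | Imp b c => truth_value v b ==> truth_value v c
  | Var _ | Box _ => v a
  end.

Definition tautology (a : formula) : Prop :=
  forall v : formula -> bool, truth_value v a.

Record modal_logic (L : set formula) : Prop := ModalLogic {
  modal_logic_taut : forall a, tautology a -> L a;
  modal_logic_K :
    L (Imp (Box (Imp (Var 0) (Var 1))) (Imp (Box (Var 0)) (Box (Var 1))));
  modal_logic_mp : forall a b, L (Imp a b) -> L a -> L b;
  modal_logic_subst : forall s a, L a -> L (subst s a);
  modal_logic_nec : forall a, L a -> L (Box a)
}.

Definition extension (L L' : set formula) : Prop :=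
  modal_logic L' /\ L `<=` L'.

Definition logic_sum (L Delta : set formula) : set formula :=
  smallest modal_logic (L `|` Delta).

Definition logicK : set formula := smallest modal_logic set0.

Definition logicK4 : set formula :=
  smallest modal_logic [set Imp (Box (Var 0)) (Box (Box (Var 0)))].

Definition finitely_axiomatizable (L : set formula) : Prop :=
  exists Delta : set formula, finite_set Delta /\ L = logic_sum logicK Delta.

(* p 0, p 1, ... and q are pairwise distinct variables. *)
Definition q : formula := Var 0.
Definition p (i : nat) : formula := Var i.+1.

(* Only the indices n >= 1 are meaningful; the value at 0 is a dummy. *)
Fixpoint formB (n : nat) : formula :=
  match n with
  | 0 => Bot
  | m.+1 =>
      match m with
      | 0 => Imp (Dia (Box (p 1))) (p 1)
      | _.+1 => Imp (Dia (And (Box (p m.+1)) (Neg (formB m)))) (p m.+1)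
      end
  end.

Definition logicK4B (n : nat) : set formula := logic_sum logicK4 [set formB n].

Definition Wid_plus (k : nat) : formula :=
  Imp
    (And q (Dia (And (Box (Neg q)) (\big[And/Top]_(i < k.+1) Dia (p i)))))
    (\big[Or/Bot]_(i < k.+1) \big[Or/Bot]_(j < k.+1 | i != j)
        Dia (And (p i) (Or (p j) (Dia (p j))))).

(* Main.v *)
Require Import Defs.
From mathcomp Require Import all_boot.
From mathcomp Require Import boolp classical_sets cardinality.

Set Implicit Arguments.
Unset Strict Implicit.
Unset Printing Implicit Defensive.

(** The logic consists of the formulas valid in all but finitely many frames
    [F 0, F 1, ...]. In [F m] a root lies below a path
    [V 0, E 0, V 1, ..., E (m-1), V m], where [E i] sees exactly [V i] and
    [V (i+1)] (besides possibly itself), together with a marker [A] that sees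
    only [V 0]; so the depth is 3 and no point other than the root sees an
    antichain of three points. The points [V i] and [E i] are reflexive exactly
    when [i] is odd, so that an edge colour and a vertex colour determine the
    direction of the path. Hence a formula [path_formula m] can say that after
    walking [m] steps from the marked vertex one can still continue; it holds in
    [F j] for all [j > m] and fails in [F m]. A finite axiomatization of the
    logic would be valid in some [F m], and then so would be [path_formula m],
    which belongs to the logic. *)

(** * Kripke semantics *)

Section Kripke.
Variables (W : Type) (R : W -> W -> Prop).

Fixpoint sat (v : nat -> W -> Prop) (x : W) (a : formula) : Prop :=
  match a with
  | Var i => v i x
  | Bot => False
  | Imp b c => sat v x b -> sat v x c
  | Box b => forall y, R x y -> sat v y b
  end.

Definition valid (a : formula) : Prop := forall v x, sat v x a.

Variable v : nat -> W -> Prop.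

Lemma sat_And x a b : sat v x (And a b) <-> sat v x a /\ sat v x b.
Proof.
split=> /= [nab | [sa sb] /(_ sa sb)//].
by split; apply: contrapT => ns; apply: nab => // sa sb; apply: ns.
Qed.

Lemma sat_Or x a b : sat v x (Or a b) <-> sat v x a \/ sat v x b.
Proof.
split=> /= [nab | [sa /(_ sa)//|//]].
by case: (pselect (sat v x a)) => [|/nab]; [left | right].
Qed.

Lemma sat_Imp x a b : sat v x (Imp a b) <-> (sat v x a -> sat v x b).
Proof. by []. Qed.

Lemma sat_Box x a : sat v x (Box a) <-> forall y, R x y -> sat v y a.
Proof. by []. Qed.

Lemma sat_notImp x a b : ~ sat v x (Imp a b) <-> sat v x a /\ ~ sat v x b.
Proof. exact: not_implyP. Qed.

Lemma sat_Dia x a : sat v x (Dia a) <-> exists2 y, R x y & sat v y a.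
Proof.
split=> /= [na | [y xy sa] /(_ y xy)/(_ sa)//].
apply: contrapT => nex; apply: na => y xy sa.
by apply: nex; exists y.
Qed.

Lemma sat_bigAnd (I : eqType) (r : seq I) (F : I -> formula) x :
  sat v x (\big[And/Top]_(i <- r) F i) <-> forall i, i \in r -> sat v x (F i).
Proof.
elim: r => [|i r IHr]; first by rewrite big_nil; split=> // _ [].
rewrite big_cons sat_And IHr; split=> [[si sr] j|sr].
  by rewrite inE => /orP[/eqP->|/sr].
by split=> [|j jr]; apply: sr; rewrite inE ?eqxx ?jr ?orbT.
Qed.

Lemma sat_bigOr (I : eqType) (r : seq I) (P : pred I) (F : I -> formula) i x :
  i \in r -> P i -> sat v x (F i) -> sat v x (\big[Or/Bot]_(i <- r | P i) F i).
Proof.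
move=> ir Pi si; elim: r ir => // j r IHr; rewrite inE big_cons.
case/orP => [/eqP<-|ir]; first by rewrite Pi; apply/sat_Or; left.
by case: ifP => _; [apply/sat_Or; right|]; apply: IHr.
Qed.

(** Truth at [x] is a truth assignment once boxed formulas are read as atoms; hence tautologies hold
    at every point. *)
Lemma truth_value_sat x a :
  truth_value (fun b => `[< sat v x b >]) a <-> sat v x a.
Proof.
elim: a => [i||b IHb c IHc|b IHb] /=; try by split=> /asboolP.
  by [].
by rewrite -IHb -IHc; split=> [/implyP|/implyP].
Qed.

Lemma sat_subst s x a :
  sat v x (subst s a) <-> sat (fun i y => sat v y (s i)) x a.
Proof.
elim: a x => [i||b IHb c IHc|b IHb] x //=; first by rewrite IHb IHc.
by split=> sb y /sb /IHb.
Qed.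

End Kripke.

(** * Soundness and frame conditions for the axioms *)

Section Validity.
Variables (W : Type) (R : W -> W -> Prop).

Lemma modal_logic_valid : modal_logic (valid R).
Proof.
split=> [a ta v x||a b sab sa v x|s a sa v x|a sa v x y _].
- by apply/truth_value_sat.
- by move=> v x /= sab sa y xy; apply: sab => //; apply: sa.
- by apply: sab; apply: sa.
- by apply/sat_subst; apply: sa.
- exact: sa.
Qed.

Lemma valid_K4 :
  (forall x y z, R x y -> R y z -> R x z) ->
  valid R (Imp (Box (Var 0)) (Box (Box (Var 0)))).
Proof. by move=> Rtr v x /= sx y xy z yz; apply: sx; apply: Rtr yz. Qed.

(** A refutation of B at [x] supplies a successor [y] where a variable false at [x] is boxed. So [y]
    does not see [x], the rank drops strictly, and the inner formula is refuted at [y]. *)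
Lemma formB_rank (rank : W -> nat) :
  (forall x y, R x y -> ~ R y x -> rank y < rank x) ->
  (forall x, 0 < rank x) ->
  forall v n x, ~ sat R v x (formB n) -> n < rank x.
Proof.
move=> rankR rank_gt0 v; elim=> [|n IHn] x nB; first exact: rank_gt0.
(* The first formula has no inner one, so for [n = 0] positivity of the rank of [y] replaces the
   induction hypothesis. *)
suff [y xy [sy ny nBy]]: exists2 y, R x y &
    [/\ sat R v y (Box (p n.+1)), ~ sat R v x (p n.+1)
      & n = 0 \/ ~ sat R v y (formB n)].
  have lt_yx: rank y < rank x by apply: rankR => // /sy.
  apply: leq_ltn_trans lt_yx.
  by case: nBy => [-> | /IHn//]; exact: rank_gt0.
case: n {IHn} nB => [|n] /sat_notImp[/sat_Dia[y xy sy] nx]; exists y => //.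
  by split=> //; left.
by move/sat_And: sy => [sy nBy]; split=> //; right.
Qed.

Lemma valid_formB (rank : W -> nat) n :
  (forall x y, R x y -> ~ R y x -> rank y < rank x) ->
  (forall x, 0 < rank x <= n) ->
  valid R (formB n).
Proof.
move=> rankR rank_n v x; apply: contrapT => nB.
suff: n < rank x by rewrite ltnNge; case/andP: (rank_n x) => _ ->.
have rank_gt0 y : 0 < rank y by case/andP: (rank_n y).
exact: formB_rank nB.
Qed.

(** The variable [q] holds at [x] and is false at all successors of [y], which makes the step from
    [x] to [y] strict. Two comparable witnesses above [y] are seen from [x] by transitivity. *)
Lemma valid_Wid_plus k :
  (forall x y z, R x y -> R y z -> R x z) ->
  (forall x y, R x y -> ~ R y x -> forall z : 'I_k.+1 -> W,
     (forall i, R y (z i)) ->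
     exists i j, i != j /\ (z i = z j \/ R (z i) (z j))) ->
  valid R (Wid_plus k).
Proof.
move=> Rtr widR v x; apply/sat_Imp.
case/sat_And=> qx /sat_Dia[y xy /sat_And[nqy /sat_bigAnd sp]].
have /choice[z zP]: forall i : 'I_k.+1, exists z, R y z /\ sat R v z (p i).
  move=> i; have /sat_Dia[z yz sz] := sp i (mem_index_enum i).
  by exists z.
have nyx : ~ R y x by move=> yx; apply: nqy yx qx.
have [i [j [ij zij]]] := widR x y xy nyx z (fun i => (zP i).1).
apply: (sat_bigOr (i := i)) => //; first exact: mem_index_enum.
apply: (sat_bigOr (i := j)) => //; first exact: mem_index_enum.
apply/sat_Dia; exists (z i); first exact: Rtr xy (zP i).1.
apply/sat_And; split; first exact: (zP i).2.
apply/sat_Or; case: zij => [->|zizj]; [left | right]; first exact: (zP j).2.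
by apply/sat_Dia; exists (z j) => //; exact: (zP j).2.
Qed.

End Validity.

(** * The logic of a sequence of frames, up to finitely many of them *)

Section EventualValidity.
Variables (W : Type) (R : nat -> W -> W -> Prop).

Definition eventually_valid : set formula :=
  fun a => exists N, forall m, N <= m -> valid (R m) a.

Lemma modal_logic_eventually_valid : modal_logic eventually_valid.
Proof.
split=> [a ta||a b [N1 sab] [N2 sa]|s a [N sa]|a [N sa]].
- by exists 0 => m _; apply: modal_logic_taut (modal_logic_valid (R m)) _ ta.
- by exists 0 => m _; apply: modal_logic_K (modal_logic_valid (R m)).
- exists (maxn N1 N2) => m; rewrite geq_max => /andP[le1 le2].
  have [_ _ mp _ _] := modal_logic_valid (R m).
  exact: mp (sab m le1) (sa m le2).
- by exists N => m /sa; apply: modal_logic_subst (modal_logic_valid (R m)) _ _.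
- by exists N => m /sa; apply: modal_logic_nec (modal_logic_valid (R m)) _.
Qed.

Lemma finite_eventually_valid (D : set formula) :
  finite_set D -> (D `<=` eventually_valid)%classic ->
  exists m, (D `<=` valid (R m))%classic.
Proof.
case/(finite_seqP (T := {classic formula})) => s -> sD.
have /choice[N NP]: forall a, exists N, eventually_valid a ->
    forall m, N <= m -> valid (R m) a.
  move=> a; case: (pselect (eventually_valid a)) => [[N aN]|na].
    by exists N.
  (* Formulas outside the logic get the default threshold 0. *)
  by exists 0.
exists (\max_(a <- s) N a) => a sa.
apply: NP (sD a sa) _ _.
exact: (@leq_bigmax_seq {classic formula} s predT N a sa isT).
Qed.

Lemma eventually_valid_not_finitely_axiomatizable (c : nat -> formula) :
  (forall m, eventually_valid (c m)) -> (forall m, ~ valid (R m) (c m)) ->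
  ~ finitely_axiomatizable eventually_valid.
Proof.
move=> ec nc [D [finD LD]].
have [m Dm] : exists m, (D `<=` valid (R m))%classic.
  apply: finite_eventually_valid => // a Da; rewrite LD.
  by apply: sub_gen_smallest; right.
apply: (nc m); move: (c m) (ec m); rewrite LD.
apply: smallest_sub; first exact: modal_logic_valid.
rewrite subUset; split=> //.
by apply: smallest_sub; [exact: modal_logic_valid|].
Qed.

Lemma extension_eventually_valid n k :
  (forall m, valid (R m) (Imp (Box (Var 0)) (Box (Box (Var 0))))) ->
  (forall m, valid (R m) (formB n)) ->
  (forall m, valid (R m) (Wid_plus k)) ->
  extension (logic_sum (logicK4B n) [set Wid_plus k]%classic) eventually_valid.
Proof.
move=> R4 RB RW; have evlog := modal_logic_eventually_valid.
split=> //; apply: smallest_sub => //; rewrite subUset; split; last first.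
  by move=> _ ->; exists 0.
apply: smallest_sub => //; rewrite subUset; split; last first.
  by move=> _ ->; exists 0.
by apply: smallest_sub => // _ ->; exists 0.
Qed.

End EventualValidity.

(** * The path frames, their depth and their width *)

Inductive point := Root | A | E of nat | V of nat.

(* The points [E i] with [i >= m] and [V i] with [i > m] are not seen from the
   root and are harmless. *)
Definition path_rel (m : nat) (x y : point) : Prop :=
  match x, y with
  | Root, A => True
  | Root, E i => i < m
  | Root, V i => i <= m
  | A, V i => i = 0
  | E i, E j => odd i /\ j = i
  | E i, V j => j = i \/ j = i.+1
  | V i, V j => odd i /\ j = i
  | _, _ => False
  end.

Lemma path_rel_trans m x y z :
  path_rel m x y -> path_rel m y z -> path_rel m x z.
Proof.
case: x y z => [||i|i] [||j|j] [||l|l] //=.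
- by move=> _ ->.
- by move=> jm [_ ->].
- by move=> jm [->|->] //; apply: ltnW.
- by move=> jm [_ ->].
- by move=> -> [].
- by move=> [? ->].
- by move=> [? ->].
- by move=> ij [_ ->].
- by move=> [? ->].
Qed.

Definition path_rank (x : point) : nat :=
  match x with Root => 3 | A | E _ => 2 | V _ => 1 end.

Lemma path_rankP m x y :
  path_rel m x y -> ~ path_rel m y x -> path_rank y < path_rank x.
Proof. by case: x y => [||i|i] [||j|j] //= [oi ->] []. Qed.

(** Being seen, [y] is not the root. Only an edge point sees two incomparable points, namely its
    endpoints: [V j] gets its own colour, while [V (j+1)] shares the other with [E j]. *)
Lemma path_two_chains m x y : path_rel m x y ->
  exists c : point -> bool, forall z z', path_rel m y z -> path_rel m y z' ->
    c z = c z' -> [\/ z = z', path_rel m z z' | path_rel m z' z].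
Proof.
move=> xy; exists (fun z => if (y, z) is (E j, V i) then i == j else false).
case: y xy => [||j|j]; first by case: x.
- by move=> _ [||i|i] [||l|l] //= -> -> _; constructor 1.
- move=> _ [||i|i] [||l|l] //=.
  + by move=> [_ ->] [_ ->]; constructor 1.
  + by move=> [_ ->] [] ->; [rewrite eqxx | constructor 2; right].
  + by move=> [] -> [_ ->]; [rewrite eqxx | constructor 3; right].
  + by move=> [] -> [] ->; rewrite ?eqxx ?gtn_eqF //; constructor 1.
- by move=> _ [||i|i] [||l|l] //= [_ ->] [_ ->] _; constructor 1.
Qed.

Lemma valid_path_Wid_plus m k : 1 < k -> valid (path_rel m) (Wid_plus k).
Proof.
move=> k_gt1; apply: valid_Wid_plus; first exact: path_rel_trans.
move=> x y xy _ z yz; have [c cP] := path_two_chains xy.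
suff [i [j [ij cij]]] : exists i j, i != j /\ c (z i) = c (z j).
  case: (cP _ _ (yz i) (yz j) cij) => zij.
  - by exists i, j; split=> //; left.
  - by exists i, j; split=> //; right.
  - by exists j, i; rewrite eq_sym; split=> //; right.
(* Pigeonhole: since [k] is at least 2 there are three indices, for two colours. *)
have lt1k : 1 < k.+1 by apply: ltnW.
pose i0 : 'I_k.+1 := ord0; pose i1 := Ordinal lt1k.
pose i2 := Ordinal (k_gt1 : 2 < k.+1).
have [e01|/eqP n01] := eqVneq (c (z i0)) (c (z i1)); first by exists i0, i1.
have [e02|/eqP n02] := eqVneq (c (z i0)) (c (z i2)); first by exists i0, i2.
exists i1, i2; split=> //.
by case: (c (z i0)) (c (z i1)) (c (z i2)) n01 n02 => [] [] [].
Qed.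

(** * Formulas defining the points of the frames *)

(** Even vertices are the dead ends. Odd ones see something but no dead end, whereas the root and
    [A] see [V 0] and every edge point has an even endpoint. *)
Definition vertex_formula (b : bool) : formula :=
  if b then And (Neg (Box Bot)) (Neg (Dia (Box Bot))) else Box Bot.

(** Endpoints of an edge have opposite colours; [A] and the vertices see at most one vertex. *)
Definition any_edge_formula : formula :=
  And (Dia (vertex_formula false)) (Dia (vertex_formula true)).

(* The edge points of odd colour are the reflexive ones, the only points above
   the root that see an edge point. *)
Definition edge_formula (b : bool) : formula :=
  if b then Dia any_edge_formula
  else And any_edge_formula (Neg (Dia any_edge_formula)).

(** Only [A] has successors all of which are dead ends: edge points and odd vertices see an odd
    vertex, and the root sees [A]. *)
Definition marker_formula : formula := And (Dia Top) (Box (Box Bot)).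

(** Of the edges at [V i], only [E i] has the parity of [i], and its endpoint of the other parity is
    [V (i+1)]. The colours thus carry variable [i] at [V i] forward to variable [i+1] at
    [V (i+1)]. *)
Definition step_formula (i : nat) : formula :=
  Box (Imp (And (edge_formula (odd i)) (Dia (Var i)))
           (Box (Imp (vertex_formula (odd i.+1)) (Var i.+1)))).

Definition walk_formula (m : nat) : formula :=
  And (Box (Imp marker_formula (Box (Var 0))))
      (\big[And/Top]_(i <- iota 0 m) step_formula i).

Definition path_formula (m : nat) : formula :=
  Imp (And (Dia marker_formula) (walk_formula m))
      (Dia (And (edge_formula (odd m)) (Dia (Var m)))).

Section PathSat.
Variables (m : nat) (v : nat -> point -> Prop).
Local Notation "x |= a" := (sat (path_rel m) v x a) (at level 70).

Lemma sat_dead x : x |= Box Bot <-> exists2 i, x = V i & ~~ odd i.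
Proof.
split=> /= [|[i ->] /negP ei [||j|j] //= [] //].
case: x => [||i|i] dead.
- by case: (dead A).
- by case: (dead (V 0)).
- by case: (dead (V i)); left.
- by exists i => //; apply/negP => oi; apply: (dead (V i)).
Qed.

Lemma sat_vertex x b :
  x |= vertex_formula b <-> exists2 i, x = V i & odd i = b.
Proof.
case: b; last first.
  rewrite sat_dead; split=> -[i ->] ei; exists i => //; first exact/negbTE.
  by rewrite ei.
rewrite /vertex_formula sat_And.
split=> [[/sat_Imp ndead /sat_Imp nDia]|[i -> oi]]; last first.
  split; first by case/sat_dead => j [<-]; rewrite oi.
  apply/sat_Imp => /sat_Dia[[||j|j]] // [_ ->] /sat_dead[l [<-]].
  by rewrite oi.
have even_unseen i : path_rel m x (V i) -> odd i.
  move=> xi; apply: contraT => ei; case: nDia; apply/sat_Dia.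
  by exists (V i) => //; apply/sat_dead; exists i.
case: x ndead nDia even_unseen => [||i|i] ndead _ even_unseen.
- by have := even_unseen 0 (leq0n m).
- by have := even_unseen 0 erefl.
- have /= := even_unseen i.+1 (or_intror erefl).
  by rewrite (even_unseen i (or_introl erefl)).
- exists i => //; apply: contraT => ei.
  by case: ndead; apply/sat_dead; exists i.
Qed.

Lemma sat_any_edge x : x <> Root -> x |= any_edge_formula <-> exists i, x = E i.
Proof.
move=> nx; rewrite /any_edge_formula sat_And; split=> [[]|[i ->]].
  case/sat_Dia=> y xy /sat_vertex[i yV ei] /sat_Dia[z xz /sat_vertex[j zV oj]].
  move: xy xz; rewrite yV zV; case: x nx => [||l|l] // _ /=.
  - by move=> _ j0; rewrite j0 in oj.
  - by exists l.
  - by move=> [ol il]; rewrite il ol in ei.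
have sees b : E i |= Dia (vertex_formula b).
  apply/sat_Dia; have [ib|nib] := boolP (odd i == b).
    by exists (V i); [left | apply/sat_vertex; exists i => //; apply/eqP].
  exists (V i.+1); [by right | apply/sat_vertex; exists i.+1 => //=].
  by case: (odd i) b nib => [] [].
by split.
Qed.

Lemma sat_edge x b : x <> Root ->
  x |= edge_formula b <-> exists2 i, x = E i & odd i = b.
Proof.
move=> nx.
have sat_refl : x |= Dia any_edge_formula <-> exists2 i, x = E i & odd i.
  rewrite sat_Dia; split=> [[y xy]|[i -> oi]]; last first.
    by exists (E i) => //; apply/sat_any_edge => //; exists i.
  have ny : y <> Root by move=> yR; move: xy; rewrite yR; case: (x).
  case/(sat_any_edge ny) => i yE; move: xy; rewrite yE.
  by case: x nx => [||j|j] //= _ [oj _]; exists j.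
case: b; first exact: sat_refl.
rewrite sat_And sat_any_edge //; split=> [[[i xE] /sat_Imp nrefl]|[i xE ei]].
  exists i => //; apply/negbTE/negP => oi; apply: nrefl.
  by apply/sat_refl; exists i.
split; first by exists i.
by case/sat_refl => j; rewrite xE => -[<-]; rewrite ei.
Qed.

Lemma sat_marker x : x |= marker_formula <-> x = A.
Proof.
rewrite sat_And; split=> [[/sat_Dia[y xy _] /sat_Box bb]|->]; last first.
  split; first by apply/sat_Dia; exists (V 0).
  by apply/sat_Box => -[||i|i] // ->; apply/sat_dead; exists 0.
have even_seen i : path_rel m x (V i) -> ~~ odd i.
  by case/bb/sat_dead => j [->].
case: x xy bb even_seen => [||i|i] // xy bb even_seen.
- by have /sat_dead[] := bb A I.
- have /= := even_seen i.+1 (or_intror erefl).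
  by rewrite even_seen //; left.
- case: y xy => // j /= [oi _].
  by have := even_seen i (conj oi erefl); rewrite oi.
Qed.

End PathSat.

(** * Validity and failure of the path formulas *)

Lemma path_formula_valid m j : m < j -> valid (path_rel j) (path_formula m).
Proof.
move=> mj v x; apply/sat_Imp => /sat_And[/sat_Dia[y xy /sat_marker ya]].
(* Only the root sees the marker. *)
have {y xy ya} -> : x = Root by move: xy; rewrite ya; case: x.
case/sat_And=> start /sat_bigAnd step.
have walk i : i <= m -> v i (V i).
  elim: i => [|i IHi] im; first by apply: (start A) => //; apply/sat_marker.
  have ij : i < j by apply: ltn_trans mj.
  have /step/sat_Box/(_ (E i) ij)/sat_Imp stepE : i \in iota 0 m.
    by rewrite mem_iota.
  have /stepE/sat_Box/(_ (V i.+1) (or_intror erefl))/sat_Imp :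
      sat (path_rel j) v (E i) (And (edge_formula (odd i)) (Dia (Var i))).
    apply/sat_And; split; first by apply/sat_edge => //; exists i.
    by apply/sat_Dia; exists (V i); [left | apply/IHi/ltnW].
  by apply; apply/sat_vertex; exists i.+1.
apply/sat_Dia; exists (E m) => //; apply/sat_And; split.
  by apply/sat_edge => //; exists m.
by apply/sat_Dia; exists (V m); [left | apply: walk].
Qed.

(** Let variable [i] hold at [V i] alone. Every step is then correct, but continuing after [m] steps
    would need [E m], which the root does not see in frame [m]. *)
Lemma path_formula_not_valid m : ~ valid (path_rel m) (path_formula m).
Proof.
pose val i x := x = V i.
(* An edge [E j] ending at [V i] with the parity of [i] leaves [V i] forwards. *)
have V_edge i j : odd j = odd i -> i = j \/ i = j.+1 -> i = j.
  by move=> eq_ji [//|ei]; move: eq_ji; rewrite ei /=; case: odd.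
have nRoot x : path_rel m Root x -> x <> Root by case: x.
move=> /(_ val Root)/sat_Imp walk_on.
have /walk_on/sat_Dia[x Rx] :
    sat (path_rel m) val Root (And (Dia marker_formula) (walk_formula m)).
  apply/sat_And; split.
    by apply/sat_Dia; exists A => //; apply/sat_marker.
  apply/sat_And; split.
    apply/sat_Box => x Rx; apply/sat_Imp => /sat_marker ->.
    by apply/sat_Box => -[||i|i] // ->.
  apply/sat_bigAnd => i _; apply/sat_Box => x /nRoot nx; apply/sat_Imp.
  case/sat_And => /(sat_edge _ _ _ nx)[j -> oj] /sat_Dia[y jy yV].
  apply/sat_Box => z jz; apply/sat_Imp => /sat_vertex[l zV ol].
  move: jy jz; rewrite yV zV => /(V_edge _ _ oj) -> [] li; rewrite li //.
  by move: ol; rewrite li /= oj; case: odd.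
case/sat_And => /(sat_edge _ _ _ (nRoot _ Rx))[j xE oj] /sat_Dia[y xy yV].
move: Rx xy; rewrite xE yV /= => jm /(V_edge _ _ oj) mj.
by rewrite mj ltnn in jm.
Qed.

Theorem theorem3p5 (n k : nat) (hn : 3 <= n) (hk : 2 <= k) :
  exists L : set formula,
    extension (logic_sum (logicK4B n) [set Wid_plus k]%classic) L /\
    ~ finitely_axiomatizable L.
Proof.
exists (eventually_valid path_rel); split.
  apply: extension_eventually_valid => m.
  - by apply: valid_K4; exact: path_rel_trans.
  (* Ranks lie between 1 and 3, and [n] is at least 3. *)
  - apply: (valid_formB (rank := path_rank)); first exact: path_rankP.
    by case=> [||i|i] /=; rewrite // (leq_trans _ hn).
  - exact: valid_path_Wid_plus.
apply: (eventually_valid_not_finitely_axiomatizable (c := path_formula)).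
  by move=> m; exists m.+1 => j; apply: path_formula_valid.
exact: path_formula_not_valid.
Qed.
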